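(* For $n>1$ and $a\in\mathbb{Z}/n\mathbb{Z}$, let $m_a:\mathbb{Z}/n\mathbb{Z}\to\mathbb{Z}/n\mathbb{Z}$, $m_a(x)=ax$. Then $n$ is prime if and only if for all $a\not\equiv0\pmod n$ the map $m_a$ is injective.
   Context: Here $n$ is prime means $n>1$ and $\forall a,b\le n\,\neg(a>1\wedge b>1\wedge ab=n)$, with $a,b$ positive integers. Logic is intuitionistic; injectivity is the cancellation property $ax=ay\Rightarrow x=y$. *)

(* Defs.v *)
From mathcomp Require Import all_boot all_algebra.

Set Implicit Arguments.
Unset Strict Implicit.
Unset Printing Implicit Defensive.

Import GRing.Theory.

(* Primality as a negated bounded search for a factorization, rather than the
   boolean [prime] of the library; [a] and [b] range over positive integers. *)
Definition nat_prime (n : nat) : Prop :=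
  1 < n /\
  forall a b : nat, 0 < a -> 0 < b -> a <= n -> b <= n ->
    ~ (1 < a /\ 1 < b /\ a * b = n).

(* ['Z_n] is the ring of integers mod n only for 1 < n. *)
Definition mulZ (n : nat) (a : 'Z_n) : 'Z_n -> 'Z_n := fun x => (a * x)%R.

(* Main.v *)
Require Import Defs.
From mathcomp Require Import all_boot all_algebra.

(** The link between the two sides is the element [d = gcdn a n].  It divides
    [n], so primality leaves only [d = 1] and [d = n]; the latter means that
    [a] vanishes mod [n], so a nonzero [a] is coprime to [n], hence a unit, and
    a unit can be cancelled ([nat_prime_unitZ]).  Conversely, a proper
    factorization [n = a * b] makes [a] a zero divisor: [mulZ a] sends both
    [b] and [0] to [0] although neither [a] nor [b] is divisible by [n]. *)

Import GRing.Theory.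

Lemma natrZ_eq0 (n k : nat) : 1 < n -> ((k%:R : 'Z_n) == 0)%R = (n %| k).
Proof. by move=> n_gt1; rewrite -val_eqE /= val_Zp_nat. Qed.

(** In terms of the bounded search, [gcdn n a] is one factor and its
    cofactor in [n] the other; the cofactor exceeds 1 because [a <> 0]. *)
Lemma nat_prime_unitZ (n : nat) (a : 'Z_n) :
  nat_prime n -> a <> 0%R -> a \is a GRing.unit.
Proof.
move=> [n_gt1 noFactors] /eqP a_neq0.
have n_gt0 : 0 < n := ltnW n_gt1.
rewrite -(natr_Zp a) natrZ_eq0 // in a_neq0 *.
rewrite unitZpE // /coprime; set d := gcdn n a.
have d_gt0 : 0 < d by rewrite gcdn_gt0 n_gt0.
have dvd_dn : d %| n := dvdn_gcdl n a.
have q_gt1 : 1 < n %/ d.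
  rewrite ltn_divRL // mul1n ltn_neqAle dvdn_leq // andbT.
  by apply: contraNneq a_neq0 => /gcdn_idPl.
rewrite eqn_leq d_gt0 andbT leqNgt; apply/negP => d_gt1.
apply: (noFactors d (n %/ d)) => //; first exact: ltnW.
- exact: dvdn_leq.
- exact: leq_div.
- by rewrite mulnC divnK.
Qed.

Theorem theorem5p2p1 (n : nat) (hn : 1 < n) :
  nat_prime n <-> (forall a : 'Z_n, a <> 0%R -> injective (mulZ a)).
Proof.
split=> [n_prime a a_neq0 | mulZ_inj].
  exact: mulrI _ (nat_prime_unitZ _ _ n_prime a_neq0).
split=> // a b a_gt0 b_gt0 _ _ [a_gt1 [b_gt1 def_n]].
have a_neq0 : (a%:R : 'Z_n)%R <> 0%R.
  by apply/eqP; rewrite natrZ_eq0 // gtnNdvd // -def_n ltn_Pmulr.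
have /eqP : (b%:R : 'Z_n)%R = 0%R.
  apply: (mulZ_inj _ a_neq0); apply/eqP.
  by rewrite /mulZ mulr0 -natrM natrZ_eq0 // def_n.
by rewrite natrZ_eq0 // gtnNdvd // -def_n ltn_Pmull.
Qed.
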